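(* Let $n\ge m\ge 2$ be integers and let $q>p\ge 1$ be real numbers. If $A$ is an $m\times n$ complex matrix, then $$m^{-1/p}\|A\|_p\le m^{-1/q}\|A\|_q .$$ If $A\ne 0$, equality holds if and only if the following equivalent conditions hold: (i) $A$ has $m$ nonzero singular values, which are equal; (ii) $AA^*$ is a scalar multiple of the identity matrix $I_m$.
   Context: For an $m\times n$ complex matrix $A$ with $n\ge m$ and singular values $\sigma_1(A)\ge\cdots\ge\sigma_m(A)$, the Schatten $p$-norm ($p\ge1$ real) is $\|A\|_p:=(\sigma_1^p(A)+\cdots+\sigma_m^p(A))^{1/p}$. $A^*$ is the conjugate transpose of $A$. *)

(* Defs.v *)
From HB Require Import structures.
From mathcomp Require Import all_boot all_order all_algebra.
From mathcomp Require Import complex.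
From mathcomp Require Import reals exp.

Set Implicit Arguments.
Unset Strict Implicit.
Unset Printing Implicit Defensive.

Import Order.TTheory GRing.Theory Num.Theory.
Local Open Scope ring_scope.
Local Open Scope sesquilinear_scope.
Local Open Scope complex_scope.

(* The m x m matrix A *m A^t* is Hermitian, so [spectral_diag] lists its
   eigenvalues with multiplicity and they are real and nonnegative; see
   [char_poly_singular_value] below.  For n >= m these are all the singular
   values of A; for n < m the list is padded with m - n zeros. *)
Definition singular_values (R : realType) (m n : nat) (A : 'M[R[i]]_(m, n)) :
    m.-tuple R :=
  sort_tuple >=%R
    [tuple Num.sqrt (complex.Re (spectral_diag (A *m A ^t*) 0 i)) | i < m].

Definition singular_value (R : realType) (m n : nat) (A : 'M[R[i]]_(m, n))
    (i : 'I_m) : R :=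
  tnth (singular_values A) i.

Definition schatten_norm (R : realType) (m n : nat) (p : R)
    (A : 'M[R[i]]_(m, n)) : R :=
  (\sum_(i < m) singular_value A i `^ p) `^ p^-1.

Section SingularValueFacts.
Variables (R : realType) (m n : nat) (A : 'M[R[i]]_(m, n)).

Lemma singular_value_ge0 (i : 'I_m) : 0 <= singular_value A i.
Proof.
have : singular_value A i \in singular_values A by apply: mem_tnth.
by rewrite mem_sort => /mapP[j _ ->]; apply: sqrtr_ge0.
Qed.

Lemma singular_value_nonincreasing (i j : 'I_m) :
  (i <= j)%N -> singular_value A j <= singular_value A i.
Proof.
move=> leij; rewrite /singular_value !(tnth_nth 0).
have tr : transitive (>=%R : rel R) by move=> x y z /= yx xz; apply: le_trans xz yx.
have rf : reflexive (>=%R : rel R) by move=> x /=; apply: lexx.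
apply: (sorted_leq_nth tr rf 0) => //; rewrite ?inE ?size_tuple //.
by apply: sort_sorted => x y /=; apply: le_total.
Qed.

Lemma char_poly_singular_value :
  char_poly (A *m A ^t*) =
  \prod_(i < m) ('X - ((singular_value A i ^+ 2)%:C)%:P).
Proof.
set B := A *m A ^t*.
have hB : B ^t* = B by rewrite /B trmx_mul map_mxM trmxCK.
have nB : B \is normalmx by apply/normalmxP; rewrite hB.
have /orthomx_spectralP eB := nB.
set P := spectralmx B in eB; set d := spectral_diag B in eB.
have uP : P \in unitmx by apply: spectral_unit.
have UP : P \is unitarymx by apply: spectral_unitarymx.
have eD : diag_mx d = (P *m A) *m (P *m A) ^t*.
  rewrite trmx_mul map_mxM mulmxA -(mulmxA P) -/B [B]eB.
  by rewrite !mulmxA mulmxV // mul1mx -mulmxA -invmx_unitary // mulmxV // mulmx1.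
have dge0 i : 0 <= d 0 i.
  have -> : d 0 i = (diag_mx d) i i by rewrite mxE eqxx mulr1n.
  by rewrite eD mxE sumr_ge0 // => k _; rewrite !mxE mul_conjC_ge0.
have dE i : ((Num.sqrt (complex.Re (d 0 i))) ^+ 2)%:C = d 0 i.
  have := dge0 i; case: (d 0 i) => a b; rewrite lecE /= => /andP[/eqP b0 a0].
  by rewrite sqr_sqrtr // b0.
have -> : char_poly B = char_poly (diag_mx d).
  rewrite /char_poly /char_poly_mx [in LHS]eB !map_mxM.
  have {1}-> : ('X%:M : 'M[{poly R[i]}]_m) =
    map_mx polyC (invmx P) *m 'X%:M *m map_mx polyC P.
    by rewrite scalar_mxC -mulmxA -map_mxM mulVmx // map_mx1 mulmx1.
  rewrite -mulmxBl -mulmxBr !det_mulmx mulrC mulrA -det_mulmx -map_mxM mulmxV //.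
  by rewrite map_mx1 det1 mul1r.
rewrite char_poly_trig ?diag_mx_is_trig //.
rewrite (eq_bigr (fun i => 'X - (((Num.sqrt (complex.Re (d 0 i))) ^+ 2)%:C)%:P)); last first.
  by move=> i _; rewrite dE mxE eqxx mulr1n.
pose F (x : R) := 'X - ((x ^+ 2)%:C)%:P.
rewrite -(big_tuple _ _ (singular_values A) xpredT F).
by rewrite (perm_big _ (permEl (perm_sort _ _))) /= big_map big_enum.
Qed.

End SingularValueFacts.

(* Main.v *)
Require Import Defs.
From mathcomp Require Import all_boot all_order all_algebra.
From mathcomp Require Import complex.
From mathcomp Require Import ring lra.
From mathcomp Require Import reals sequences exp.

(** The singular values [x_i] of [A] are nonnegative reals, and
    [m `^ (- p^-1) * schatten_norm p A] is their power mean
    [(((\sum_i x_i `^ p) / m) `^ p^-1)].  So the inequality says that power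
    means of nonnegative numbers increase with the exponent, strictly unless
    the numbers are all equal ([power_mean_leif]).  This is Jensen's inequality
    for the convex function [t `^ (q / p)] applied to the numbers [x_i `^ p]
    ([jensen_powR]).  After dividing by the mean, Jensen's inequality is the
    sum over [i] of Bernoulli's inequality [1 + r * (t - 1) <= t `^ r], which
    is strict for [t != 1] ([bernoulli_powR]).  All these inequalities are
    stated with [_ <= _ ?= iff _], which carries the equality case along.

    For the second part, the eigenvalues of the normal matrix [A *m A ^t*] are
    the squares of the singular values of [A], and a normal matrix is scalar as
    soon as it has a single eigenvalue.  Hence [A *m A ^t*] is scalar if and
    only if all singular values are equal.  Their common value is nonzero when
    [A] is, for [A *m A ^t* = 0] implies [A = 0] ([gram_eq0]). *)

Set Implicit Arguments.
Unset Strict Implicit.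
Unset Printing Implicit Defensive.

Import Order.TTheory GRing.Theory Num.Theory.
Local Open Scope ring_scope.
Local Open Scope sesquilinear_scope.
Local Open Scope complex_scope.

(** For [t > 0], put [v = ln t].  The claim divided by [t] reads
    [r <= expR ((r - 1) * v) + (r - 1) * expR (- v)].  The inequality
    [1 + u <= expR u] bounds the two exponentials below by [1 + (r - 1) * v]
    and [1 - v]; the terms in [v] cancel and leave [r].  Both bounds are strict
    for [v != 0]. *)
Lemma bernoulli_powR (R : realType) (r t : R) : 1 < r -> 0 <= t ->
  1 + r * (t - 1) <= t `^ r ?= iff (t == 1).
Proof.
move=> r_gt1; have r_gt0 : 0 < r by apply: lt_trans r_gt1.
rewrite le_eqVlt => /predU1P[<-|t_gt0].
  rewrite powR0 ?(gt_eqF r_gt0)// eq_sym oner_eq0; split; first lra.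
  by apply/negbTE; rewrite lt_eqF//; lra.
have [->|t_neq1] := eqVneq t 1.
  by rewrite powR1 subrr mulr0 addr0; apply/leif_refl.
have v_neq0 : ln t != 0.
  by apply: contra t_neq1 => /eqP v0; rewrite -(lnK t_gt0) v0 expR0.
have powE : t `^ r = t * expR ((r - 1) * ln t).
  by rewrite /powR gt_eqF// -[X in _ = X * _](lnK t_gt0) -expRD;
    congr expR; ring.
have invE : t * expR (- ln t) = 1.
  by rewrite -[X in X * _ = _](lnK t_gt0) -expRD subrr expR0.
have h1 : 1 + (r - 1) * ln t < expR ((r - 1) * ln t).
  by apply: expR_gt1Dx; rewrite mulf_neq0// subr_eq0 gt_eqF.
have h2 : 1 + - ln t < expR (- ln t) by apply: expR_gt1Dx; rewrite oppr_eq0.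
suff lt_t : 1 + r * (t - 1) < t `^ r.
  by split; [exact: ltW | rewrite lt_eqF].
have : t * r < t * (expR ((r - 1) * ln t) + (r - 1) * expR (- ln t)).
  by rewrite ltr_pM2l//; nra.
rewrite mulrDr -powE mulrCA invE; lra.
Qed.

(** The tangent line at the mean [M] supports the graph of [t `^ r]; summing
    the support inequality over the points gives the claim.  Bernoulli's
    inequality is this support line after scaling to [M = 1]. *)
Lemma jensen_powR (R : realType) (I : finType) (r : R) (y : I -> R) :
  (0 < #|I|)%N -> 1 < r -> (forall i, 0 <= y i) ->
  ((\sum_i y i) / #|I|%:R) `^ r <= (\sum_i y i `^ r) / #|I|%:R
    ?= iff [forall i, forall j, y i == y j].
Proof.
move=> I_gt0 r_gt1 y_ge0; set N : R := #|I|%:R; set M := _ / N.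
have r_gt0 : 0 < r by apply: lt_trans r_gt1.
have N_gt0 : 0 < N by rewrite ltr0n.
have sumE : \sum_i y i = M * N by rewrite /M divfK// gt_eqF.
have M_ge0 : 0 <= M by rewrite divr_ge0 ?sumr_ge0// ltW.
(* The scaling is impossible for M = 0, but then every term vanishes. *)
have [M0|M_neq0] := eqVneq M 0.
  have y0 i : y i = 0.
    move: sumE; rewrite M0 mul0r => /psumr_eq0P; exact.
  rewrite M0 powR0 ?(gt_eqF r_gt0)// big1 ?mul0r.
    rewrite (_ : [forall i, _] = true); first exact/leif_refl.
    by apply/forallP => i; apply/forallP => j; rewrite !y0.
  by move=> i _; rewrite y0 powR0// gt_eqF.
have M_gt0 : 0 < M by rewrite lt0r M_neq0.
(* Numbers that are all equal are all equal to their mean. *)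
have condE : [forall i, forall j, y i == y j] = [forall i, y i / M == 1].
  apply/'forall_'forall_eqP/'forall_eqP => [eqy i|eqM i j]; last first.
    by apply: (mulIf (invr_neq0 M_neq0)); rewrite !eqM.
  rewrite (_ : y i = M) ?divff//; apply: (mulIf (lt0r_neq0 N_gt0)).
  rewrite -sumE (eq_bigr (fun=> y i)) => [|j _]; last exact: eqy.
  by rewrite sumr_const mulr_natr.
have := leif_sum (fun i (_ : xpredT i) =>
  bernoulli_powR r_gt1 (divr_ge0 (y_ge0 i) M_ge0)).
have -> : \sum_i (1 + r * (y i / M - 1)) = N.
  rewrite big_split /= sumr_const -mulr_sumr sumrB -mulr_suml sumE sumr_const.
  by rewrite mulrAC divff// mul1r subrr mulr0 addr0.
have -> : \sum_i (y i / M) `^ r = (\sum_i y i `^ r) / M `^ r.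
  rewrite mulr_suml; apply: eq_bigr => i _.
  by rewrite powRM ?invr_ge0// -powR_inv1// -powRrM mulN1r powRN.
rewrite condE => -[le_N eq_N]; have Mr_gt0 := powR_gt0 r M_gt0.
split; first by rewrite ler_pdivlMr// mulrC -ler_pdivlMr.
rewrite -eq_N eq_sym [N == _]eq_sym !(can2_eq (divfK _) (mulfK _)) ?(gt_eqF Mr_gt0)
  ?(gt_eqF N_gt0)//.
by rewrite mulrC.
Qed.

Definition power_mean (R : realType) (I : finType) (p : R) (x : I -> R) : R :=
  ((\sum_i x i `^ p) / #|I|%:R) `^ p^-1.

(** Jensen's inequality for the exponent [q / p > 1] and the numbers
    [x i `^ p], followed by the increasing and injective map [t `^ q^-1]. *)
Lemma power_mean_leif (R : realType) (I : finType) (p q : R) (x : I -> R) :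
  (0 < #|I|)%N -> 0 < p -> p < q -> (forall i, 0 <= x i) ->
  power_mean p x <= power_mean q x
    ?= iff [forall i, forall j, x i == x j].
Proof.
move=> I_gt0 p_gt0 ltpq x_ge0; have q_gt0 := lt_trans p_gt0 ltpq.
have r_gt1 : 1 < q / p by rewrite ltr_pdivlMr// mul1r.
have mean_ge0 s : 0 <= (\sum_i x i `^ s) / #|I|%:R.
  by rewrite divr_ge0// sumr_ge0// => i _; apply: powR_ge0.
have powE i : (x i `^ p) `^ (q / p) = x i `^ q.
  by rewrite -powRrM mulrCA divff ?mulr1// gt_eqF.
have := jensen_powR I_gt0 r_gt1
  (fun i => powR_ge0 (x i) p).
rewrite (eq_bigr _ (fun i _ => powE i)) => -[leM eqM].
have -> : power_mean p x =
    (((\sum_i x i `^ p) / #|I|%:R) `^ (q / p)) `^ q^-1.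
  by rewrite -powRrM mulrAC divff ?mul1r// gt_eqF.
have condE : [forall i, forall j, x i == x j] =
    [forall i, forall j, x i `^ p == x j `^ p].
  apply/'forall_'forall_eqP/'forall_'forall_eqP => eqx i j.
    by rewrite (eqx i j).
  by apply: (powR_injective p_gt0) (eqx i j); rewrite nnegrE.
split; first by rewrite ge0_ler_powR ?nnegrE ?powR_ge0// invr_ge0 ltW.
rewrite condE -eqM; apply/eqP/eqP => [|->//].
by apply: powR_injective; rewrite ?nnegrE ?powR_ge0// invr_gt0.
Qed.

Lemma schatten_norm_power_mean (R : realType) (m n : nat) (p : R)
    (A : 'M[R[i]]_(m, n)) :
  m%:R `^ (- p^-1) * schatten_norm p A = power_mean p (singular_value A).
Proof.
rewrite /schatten_norm /power_mean card_ord mulrC powRM ?invr_ge0//.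
  by rewrite -(powR_inv1 (ler0n _ _)) -powRrM mulN1r.
by apply: sumr_ge0 => i _; apply: powR_ge0.
Qed.

(** The diagonal entries of [A *m A ^t*] are the sums of the squared moduli
    over the rows of [A]. *)
Lemma gram_eq0 (C : numClosedFieldType) (m n : nat) (A : 'M[C]_(m, n)) :
  A *m A ^t* = 0 -> A = 0.
Proof.
move=> AA0; apply/matrixP => i j; rewrite mxE; apply/eqP.
have /psumr_eq0P : \sum_k A i k * (A i k)^* = 0.
  have /matrixP/(_ i i) := AA0; rewrite !mxE => AAi; rewrite -[RHS]AAi.
  by apply: eq_bigr => k _; rewrite !mxE.
move=> /(_ (fun k _ => mul_conjC_ge0 _) j isT) /eqP.
by rewrite mul_conjC_eq0.
Qed.

(** Normality provides a diagonalization whose diagonal entries are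
    eigenvalues, so it reduces to a diagonal matrix with constant diagonal. *)
Lemma normalmx_scalar (C : numClosedFieldType) (m : nat) (B : 'M[C]_m) (c : C) :
  B \is normalmx -> (forall a, eigenvalue B a -> a = c) -> B = c%:M.
Proof.
move=> /orthomx_spectralP eqB eigB.
have unitP := spectral_unit B.
suff dE : diag_mx (spectral_diag B) = c%:M.
  by rewrite {1}eqB dE -mulmxA -scalar_mxC mulKmx.
rewrite -diag_const_mx; congr diag_mx; apply/rowP => i; rewrite mxE.
(* The rows of the diagonalizing matrix are (left) eigenvectors. *)
apply: eigB; apply/eigenvalueP; exists (row i (spectralmx B)).
  by rewrite -row_mul {2}eqB !mulmxA mulmxV// mul1mx row_mul
    row_diag_mx -scalemxAl -rowE.
apply: contraTneq unitP => /rowP row0; rewrite unitmxE.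
rewrite (expand_det_row _ i) big1 ?unitr0// => j _.
by have := row0 j; rewrite !mxE => ->; rewrite mul0r.
Qed.

(** The link between singular values and the matrix [A *m A ^t*] that does not
    depend on the order in which the singular values are listed. *)
Lemma gram_eigenvalue (R : realType) (m n : nat) (A : 'M[R[i]]_(m, n))
    (a : R[i]) :
  eigenvalue (A *m A ^t*) a =
    [exists i, a == (singular_value A i ^+ 2)%:C].
Proof.
rewrite eigenvalue_root_char char_poly_singular_value.
rewrite -(big_map (fun i => (singular_value A i ^+ 2)%:C) xpredT
  (fun c => 'X - c%:P)).
rewrite root_prod_XsubC.
apply/mapP/existsP => [[i _ ->]|[i /eqP->]]; exists i => //.
by rewrite mem_index_enum.
Qed.

Lemma gram_normal (C : numClosedFieldType) (m n : nat) (A : 'M[C]_(m, n)) :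
  A *m A ^t* \is normalmx.
Proof.
by apply/normalmxP; rewrite trmx_mul map_mxM trmxCK.
Qed.

Lemma singular_values_const (R : realType) (m n : nat) (A : 'M[R[i]]_(m, n))
    (s : R) :
  (forall i, singular_value A i = s) -> A *m A ^t* = (s ^+ 2)%:C%:M.
Proof.
move=> eqs; apply: normalmx_scalar (gram_normal A) _ => a.
by rewrite gram_eigenvalue => /existsP[i /eqP->]; rewrite eqs.
Qed.

Lemma singular_value_scalar (R : realType) (m n : nat) (A : 'M[R[i]]_(m, n))
    (c : R[i]) (i : 'I_m) :
  A *m A ^t* = c%:M -> (singular_value A i ^+ 2)%:C = c.
Proof.
move=> AAc; have : eigenvalue (A *m A ^t*) (singular_value A i ^+ 2)%:C.
  by rewrite gram_eigenvalue; apply/existsP; exists i.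
rewrite AAc => /eigenvalueP[v]; rewrite mul_mx_scalar => /eqP.
rewrite -subr_eq0 -scalerBl scaler_eq0 subr_eq0.
by move=> /orP[/eqP->//|/eqP->]; rewrite eqxx.
Qed.

Theorem theorem4p9 (R : realType) (m n : nat) (p q : R)
    (hm : (2 <= m)%N) (hmn : (m <= n)%N) (hp : 1 <= p) (hpq : p < q)
    (A : 'M[R[i]]_(m, n)) :
  m%:R `^ (- p^-1) * schatten_norm p A <= m%:R `^ (- q^-1) * schatten_norm q A
  /\
  (A != 0 ->
     (m%:R `^ (- p^-1) * schatten_norm p A =
        m%:R `^ (- q^-1) * schatten_norm q A
      <-> ((forall i : 'I_m, singular_value A i != 0) /\
           (forall i j : 'I_m, singular_value A i = singular_value A j)))
     /\
     (((forall i : 'I_m, singular_value A i != 0) /\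
       (forall i j : 'I_m, singular_value A i = singular_value A j))
      <-> exists c : R[i], A *m A ^t* = c%:M)).
Proof.
have p_gt0 : 0 < p by apply: lt_le_trans hp.
have m_gt0 : (0 < #|'I_m|)%N by rewrite card_ord; apply: leq_trans hm.
have [lepq eqpq] := power_mean_leif m_gt0 p_gt0 hpq (singular_value_ge0 A).
rewrite !schatten_norm_power_mean; split=> // A_neq0.
have nz : (forall i j, singular_value A i = singular_value A j) ->
    forall i, singular_value A i != 0.
  move=> eqA i; apply: contra_neq A_neq0 => Ai0; apply: gram_eq0.
  rewrite (@singular_values_const _ _ _ _ 0) ?expr0n ?raddf0// => j.
  by rewrite (eqA j i).
split; last split=> [[_ eqA]|[c AAc]].
- by rewrite (rwP eqP) eqpq -(rwP 'forall_'forall_eqP); split=> [/[dup]/nz|[]].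
- have i0 : 'I_m := Ordinal (ltnW hm).
  by exists (singular_value A i0 ^+ 2)%:C; apply: singular_values_const.
- suff eqA i j : singular_value A i = singular_value A j by split=> //; exact: nz.
  apply: (pexpIrn (n := 2)); rewrite ?nnegrE ?singular_value_ge0//.
  by apply: complexI; rewrite !(singular_value_scalar _ AAc).
Qed.
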